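(* Let $n\ge 1$, $R>0$, $p>0$, $q>0$, $\lambda>0$, let $B_R\subset\mathbb{R}^n$ be the ball of radius $R$ centred at the origin, and let $\eta$ be the outward unit normal on $\partial B_R$. Let $u_0$ be a nonnegative, radially symmetric, nondecreasing (in $r=|x|$), smooth function on $\overline{B}_R$ satisfying $$\frac{\partial u_0}{\partial \eta}=e^{qu_0}\ \text{ on } \partial B_R,\qquad \Delta u_0+\lambda e^{pu_0}\ge 0,\quad u_{0r}(|x|)\ge 0\ \text{ for } x\in\overline{B}_R.$$ Let $u$ be a solution, with finite blow-up time $T$, of $$u_t=\Delta u+\lambda e^{pu}\ \text{ in } B_R\times(0,T),\qquad \frac{\partial u}{\partial\eta}=e^{qu}\ \text{ on }\partial B_R\times(0,T),\qquad u(x,0)=u_0(x)\ \text{ for } x\in B_R.$$ Then there is a positive constant $c$ such that $$\log c-\frac{1}{2\alpha}\log(T-t)\le u(R,t),\qquad t\in(0,T),$$ where $\alpha=\max\{p,q\}$.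
   Context: Solutions are classical solutions of the initial-boundary value problem. The solution is radial in $x$, and one writes $u(x,t)=u(r,t)$ and $u_0(x)=u_0(r)$ with $r=|x|$; thus $u(R,t)$ is the value of $u(\cdot,t)$ on $\partial B_R$. A subscript $r$ denotes the radial derivative. The blow-up time $T$ is the finite maximal existence time of the classical solution, at which $\max_{\overline{B}_R}u(\cdot,t)\to\infty$ as $t\to T^-$. *)

(* Defs.v *)
From mathcomp Require Import all_boot all_order all_algebra.
From mathcomp Require Import all_classical all_reals all_analysis.

Set Implicit Arguments.
Unset Strict Implicit.
Unset Printing Implicit Defensive.

Import Order.TTheory GRing.Theory Num.Theory.
Import numFieldNormedType.Exports.

Local Open Scope classical_set_scope.
Local Open Scope ring_scope.

(* The library norm on 'rV[R]_n is the sup norm; balls, spheres and radial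
   symmetry refer to the Euclidean norm below.  The two norms induce the same
   topology, so the library notions of continuity and of limit apply as is. *)
Definition enorm (R : realType) (n : nat) (x : 'rV[R]_n) : R :=
  Num.sqrt (\sum_(i < n) x 0 i ^+ 2).

Definition eball (R : realType) (n : nat) (rho : R) : set 'rV[R]_n :=
  [set x | enorm x < rho].

Definition ecball (R : realType) (n : nat) (rho : R) : set 'rV[R]_n :=
  [set x | enorm x <= rho].

Definition esphere (R : realType) (n : nat) (rho : R) : set 'rV[R]_n :=
  [set x | enorm x = rho].

(* [partials [:: i1; ..; ik] f] is the iterated partial derivative
   d_i1 (.. (d_ik f)). *)
Definition partials (R : realType) (n : nat) (s : seq 'I_n)
    (f : 'rV[R]_n -> R) : 'rV[R]_n -> R :=
  foldr (fun i g x => 'D_(delta_mx 0 i) g x) f s.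

Definition laplacian (R : realType) (n : nat) (f : 'rV[R]_n -> R)
    (x : 'rV[R]_n) : R :=
  \sum_(i < n) partials [:: i; i] f x.

(* Smoothness on a set that is not open means smoothness on an open
   neighbourhood; the derivatives at boundary points are then the usual
   two-sided ones, and on the closure of an open set they do not depend on the
   values of f outside. *)
Definition smooth_on (R : realType) (n : nat) (A : set 'rV[R]_n)
    (f : 'rV[R]_n -> R) : Prop :=
  exists U : set 'rV[R]_n,
    [/\ open U, A `<=` U &
      forall (s : seq 'I_n) (x : 'rV[R]_n), U x ->
        {for x, continuous (partials s f)} /\
        forall i : 'I_n, derivable (partials s f) x (delta_mx 0 i)].

(* First basis vector, written so that it makes sense for every n; it is a
   unit vector as soon as 0 < n. *)
Definition unit_vec (R : realType) (n : nat) : 'rV[R]_n :=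
  \row_(j < n) (nat_of_ord j == 0%N)%:R.

Definition radial_on (R : realType) (n : nat) (A : set 'rV[R]_n)
    (f : 'rV[R]_n -> R) : Prop :=
  forall x y : 'rV[R]_n, A x -> A y -> enorm x = enorm y -> f x = f y.

(* f(r), when f is radial and f(x) is written f(|x|). *)
Definition profile (R : realType) (n : nat) (f : 'rV[R]_n -> R) (r : R) : R :=
  f (r *: unit_vec R n).

(* f has outward normal derivative d at the point x of the sphere of radius
   rho.  The difference quotient only uses values of f in the closed ball. *)
Definition has_normal_derivative (R : realType) (n : nat) (rho : R)
    (f : 'rV[R]_n -> R) (x : 'rV[R]_n) (d : R) : Prop :=
  (fun h : R => (f x - f (x - h *: (rho^-1 *: x))) / h) @ 0^'+ --> d.

(* C^{2,1}(B x (0,T)), C^{1,0}(closure of B x (0,T)) and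
   C(closure of B x [0,T)), where B is the open ball of radius rho. *)
Definition classical_regularity (R : realType) (n : nat) (rho T : R)
    (u : 'rV[R]_n -> R -> R) : Prop :=
  [/\ forall (x : 'rV[R]_n) (t : R), eball rho x -> 0 < t < T ->
        [/\ forall s : seq 'I_n, (size s <= 2)%N ->
              {for (x, t), continuous
                 (fun z : 'rV[R]_n * R => partials s (u ^~ z.2) z.1)},
            forall (s : seq 'I_n) (i : 'I_n), (size s <= 1)%N ->
              derivable (partials s (u ^~ t)) x (delta_mx 0 i),
            derivable (u x) t 1 &
            {for (x, t), continuous
               (fun z : 'rV[R]_n * R => derive1 (u z.1) z.2)}],
      forall i : 'I_n, exists g : 'rV[R]_n * R -> R,
        {within ecball rho `*` [set t | 0 < t < T], continuous g} /\
        forall (x : 'rV[R]_n) (t : R), eball rho x -> 0 < t < T ->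
          g (x, t) = partials [:: i] (u ^~ t) x &
      {within ecball rho `*` [set t | 0 <= t < T], continuous
         (fun z : 'rV[R]_n * R => u z.1 z.2)}].

(* Classical solution on [0,T) of
     u_t = Delta u + lambda e^{pu} in the ball,
     du/deta = e^{qu} on the sphere,   u(.,0) = u0. *)
Definition classical_solution (R : realType) (n : nat)
    (rho p q lambda T : R) (u0 : 'rV[R]_n -> R) (u : 'rV[R]_n -> R -> R)
    : Prop :=
  [/\ classical_regularity rho T u,
      forall (x : 'rV[R]_n) (t : R), eball rho x -> 0 < t < T ->
        derive1 (u x) t = laplacian (u ^~ t) x + lambda * expR (p * u x t),
      forall (x : 'rV[R]_n) (t : R), esphere rho x -> 0 < t < T ->
        has_normal_derivative rho (u ^~ t) x (expR (q * u x t)) &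
      forall x : 'rV[R]_n, eball rho x -> u x 0 = u0 x].

(* T is the (finite) maximal existence time of the classical solution u, and
   the maximum of u(.,t) over the closed ball tends to +oo as t -> T^-. *)
Definition blowup_time (R : realType) (n : nat)
    (rho p q lambda T : R) (u0 : 'rV[R]_n -> R) (u : 'rV[R]_n -> R -> R)
    : Prop :=
  [/\ 0 < T,
      classical_solution rho p q lambda T u0 u,
      ~ (exists (T' : R) (v : 'rV[R]_n -> R -> R),
           [/\ T < T', classical_solution rho p q lambda T' u0 v &
               forall (x : 'rV[R]_n) (t : R), ecball rho x -> 0 <= t < T ->
                 v x t = u x t]) &
      (fun t : R => sup [set u x t | x in ecball rho]) @ T^'- --> +oo].

(* Main.v *)
(* Monotonicity in r is kept in time. Since u is only C^2 in x, the equation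
   cannot be differentiated for u_r; instead the variables are doubled:
   exp(-kt) (u(x,t) - u(y,t)) cannot have a positive maximum on
   |x| <= |y| <= rho, because it vanishes for |x| = |y|, the flux at |y| = rho
   is positive, and at an interior maximum Delta u(x,t) <= 0 <= Delta u(y,t).
   Hence m := u(rho,t0) is the maximum of u(.,t0).

   If m >= 0, the barrier m + exp(N (|x|^2 - rho^2)) + B (t - t0) with N of
   order exp(alpha m) and B of order exp(2 alpha m) is a strict supersolution
   as long as B (t - t0) <= 1, so u <= m + 2 there, and the blow-up time
   satisfies T - t0 >= 1/B, which is the claim. If m < 0, the same argument
   with 0 in place of m keeps t0 away from T, and compactness bounds
   u(rho,t0) from below. *)

Require Import Defs.
From mathcomp Require Import all_boot all_order all_algebra.
From mathcomp Require Import all_classical all_reals all_analysis.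
From mathcomp Require Import ring lra.

Set Implicit Arguments.
Unset Strict Implicit.
Unset Printing Implicit Defensive.

Import Order.TTheory GRing.Theory Num.Theory.
Import numFieldNormedType.Exports.

Local Open Scope classical_set_scope.
Local Open Scope ring_scope.

(** * One-variable calculus: first and second derivatives at maxima *)

Lemma near_right0P (R : realType) (P : set R) :
  (\forall h \near 0^'+, P h) <-> exists2 e, 0 < e & forall h, 0 < h < e -> P h.
Proof.
split=> [|[e e0 eP]]; last first.
  by near=> h; apply: eP; apply/andP.
rewrite near_withinE => /nbhs_ballP[e /= e0 eP]; exists e => // h /andP[h0 he].
by apply: eP => //; rewrite /ball /= sub0r normrN gtr0_norm.
Unshelve. all: by end_near. Qed.

(** All left difference quotients are nonnegative. Only earlier times are compared because the
    extremal time may be the last one of the time interval considered. *)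
Lemma left_max_derive1_ge0 (R : realType) (g : R -> R) (t : R) :
  derivable g t 1 -> (\forall s \near t^'-, g s <= g t) -> 0 <= derive1 g t.
Proof.
move=> dg /nbhs_left0P/near_right0P[e e0 gmax].
have cvgl : h^-1 *: (g (h *: 1 + t) - g t) @[h --> 0^'-] --> 'D_1 g t.
  by apply: cvg_dnbhs_at_left; exact: dg.
rewrite derive1E; apply: (cvgr_to_ge cvgl).
apply/nbhs_left0P/near_right0P; exists e => // h /andP[h0 he].
rewrite sub0r invrN scaleNr -scalerN opprB /GRing.scale/= mulr1 mulr_ge0//.
  by rewrite invr_ge0 ltW.
by rewrite subr_ge0 addrC; apply: gmax; rewrite h0.
Qed.

(** Fermat gives [dg 0 = 0]. If [ddg] were positive, [dg] would be positive just to the right of 0,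
    and the mean value theorem would give [g s > g 0] for a small [s > 0]. Only differentiability of
    [dg] at the single point 0 enters, not continuity of a second derivative. *)
Lemma local_max_derive2_le0 (R : realType) (g dg : R -> R) (ddg : R) :
  (\forall s \near (0 : R), is_derive (s : R) (1 : R) g (dg s)) -> is_derive (0 : R) (1 : R) dg ddg ->
  (\forall s \near (0 : R), g s <= g 0) -> ddg <= 0.
Proof.
move=> g1 g2 gmax; rewrite leNgt; apply/negP => ddg_gt0.
have /nbhs_ballP[e /= e0 He] :
    \forall s \near (0 : R), is_derive (s : R) (1 : R) g (dg s) /\ g s <= g 0.
  by near=> s; split; near: s.
have be (s : R) : s \in `](- e), e[ -> is_derive (s : R) (1 : R) g (dg s) /\ g s <= g 0.
  move=> se; apply: He; rewrite /ball /= sub0r normrN ltr_norml.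
  by move: se; rewrite in_itv.
have dg0 : dg 0 = 0.
  have d0 : 0 \in `](- e), e[ by rewrite in_itv /=; apply/andP; split; lra.
  have [g10 _] := be _ d0.
  rewrite -(@derive_val _ _ _ _ _ _ _ g10); apply: derive_val.
  apply: (@derive1_at_max _ g (- e) e) => //; first by lra.
  - by move=> t /be[? _].
  - by move=> t /be[].
have cvgr : h^-1 *: (dg (h *: 1 + 0) - dg 0) @[h --> 0^'+] --> ddg.
  by apply: cvg_dnbhs_at_right; rewrite -(@derive_val _ _ _ _ _ _ _ g2); exact: (@ex_derive _ _ _ _ _ _ _ g2).
have /cvgr_gt /(_ _ ddg_gt0) /near_right0P[d d0 dpos] := cvgr.
pose s := Num.min d e / 2.
have [s0 [sd se]] : 0 < s /\ s < d /\ s < e.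
  by rewrite /s minEle; case: ifP; lra.
have [||c] := @MVT _ g dg 0 s s0.
- move=> x; rewrite in_itv/= => /andP[x0 xs]; apply: (be _ _).1.
  by rewrite in_itv/=; apply/andP; split; lra.
- apply: derivable_within_continuous => x; rewrite in_itv/= => /andP[x0 xs].
  have xe : x \in `](- e), e[ by rewrite in_itv/=; apply/andP; split; lra.
  by have [? _] := be _ xe.
rewrite in_itv/= => /andP[c0 cs] gs.
have gs0 : g s <= g 0 by apply: (be _ _).2; rewrite in_itv/=; apply/andP; split; lra.
have : 0 < c^-1 *: (dg (c *: 1 + 0) - dg 0).
  by apply: dpos; apply/andP; split; lra.
rewrite dg0 subr0 addr0 /GRing.scale/= mulr1 pmulr_rgt0 ?invr_gt0// => gc0.
suff : 0 < dg c * (s - 0) by rewrite -gs; lra.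
by rewrite subr0 mulr_gt0.
Unshelve. all: by end_near. Qed.

(** * Euclidean norm and compactness *)

Lemma enorm_ge0 (R : realType) n (x : 'rV[R]_n) : 0 <= enorm x.
Proof. exact: sqrtr_ge0. Qed.

Lemma sqr_enorm (R : realType) n (x : 'rV[R]_n) :
  enorm x ^+ 2 = \sum_(i < n) x 0 i ^+ 2.
Proof. by rewrite sqr_sqrtr// sumr_ge0// => i _; exact: sqr_ge0. Qed.

Lemma enormZ (R : realType) n (k : R) (x : 'rV[R]_n) :
  enorm (k *: x) = `|k| * enorm x.
Proof.
rewrite /enorm -sqrtr_sqr -sqrtrM ?sqr_ge0// mulr_sumr; congr Num.sqrt.
by apply: eq_bigr => i _; rewrite mxE exprMn.
Qed.

Lemma enorm_unit_vec (R : realType) n : (0 < n)%N -> enorm (unit_vec R n) = 1.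
Proof.
case: n => // n _; rewrite /enorm (bigD1 ord0)//= mxE/= expr1n big1 ?addr0 ?sqrtr1//.
by move=> i i0; rewrite mxE; case: i i0 => -[|i]//= *; rewrite expr0n.
Qed.

Lemma enorm_continuous (R : realType) n : continuous (@enorm R n).
Proof.
have sumc : continuous (fun x : 'rV[R]_n => \sum_(i < n) x 0 i ^+ 2).
  apply: continuous_big => [z|i _ x].
    by apply: cvgD; [exact: cvg_fst|exact: cvg_snd].
  by apply: (@continuous_comp _ _ _ (fun x : 'rV[R]_n => x 0 i) (@GRing.exp R ^~ 2%N));
    [exact: coord_continuous|exact: exprn_continuous].
by move=> x; apply: continuous_comp; [exact: sumc|exact: sqrt_continuous].
Qed.

Lemma compact_ecball (R : realType) n (rho : R) : compact (ecball rho : set 'rV[R]_n).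
Proof.
have box := @rV_compact R n (fun=> `[- rho, rho]%classic) (fun=> @segment_compact R (- rho) rho).
apply: (subclosed_compact _ box).
  apply: (@preimage_closed _ _ (@enorm R n) [set x | x <= rho]).
    by move=> x _; exact: enorm_continuous.
  exact: closed_le.
move=> x xrho i; rewrite /= in_itv/= -ler_norml -sqrtr_sqr; apply: le_trans xrho.
rewrite ler_wsqrtr// (bigD1 i)//= lerDl sumr_ge0// => j _; exact: sqr_ge0.
Qed.

(** As [f] is continuous only within [K], its superlevel set is closed in the subspace topology: it
    is the trace on [K] of a closed set [V], hence compact. *)
Lemma compact_superlevel (R : realType) (X : topologicalType) (K : set X) (f : X -> R) (a : R) :
  closed K -> compact K -> {within K, continuous f} -> compact (K `&` [set x | a <= f x]).
Proof.
move=> Kcl Kco fc.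
have cl (A : set R) : closed A -> closed (f @^-1` A : set (subspace K)).
  by move: A; apply/continuous_closedP.
have /closed_subspaceP[V Vcl VE] := cl _ (@closed_ge R a).
rewrite -[X in K `&` X]/(f @^-1` [set x | a <= x]) setIC -VE setIC.
exact: compact_closedI.
Qed.

(** * Partial derivatives as derivatives along lines, and their signs at extrema *)

Lemma line_quotient (R : realType) (V : normedModType R) (f : V -> R) (x v : V) (s : R) :
  (fun h : R => h^-1 *: (((fun s : R => f (x + s *: v)) \o shift s) (h *: 1) - f (x + s *: v))) =
  (fun h : R => h^-1 *: ((f \o shift (x + s *: v)) (h *: v) - f (x + s *: v))).
Proof.
apply/funext => h /=; congr (_ *: (f _ - _)).
by rewrite scalerDl addrCA /GRing.scale/= mulr1.
Qed.

Lemma derive_along_line (R : realType) (V : normedModType R) (f : V -> R) (x v : V) (s : R) :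
  derive1 (fun s : R => f (x + s *: v)) s = 'D_v f (x + s *: v).
Proof. by rewrite derive1E /derive line_quotient. Qed.

Lemma derivable_along_line (R : realType) (V : normedModType R) (f : V -> R) (x v : V) (s : R) :
  derivable f (x + s *: v) v -> derivable (fun s : R => f (x + s *: v)) s 1.
Proof. by rewrite /derivable line_quotient. Qed.

Lemma is_derive_along_line (R : realType) (V : normedModType R) (f : V -> R) (x v : V) (s : R) :
  derivable f (x + s *: v) v -> is_derive (s : R) (1 : R) (fun s : R => f (x + s *: v)) ('D_v f (x + s *: v)).
Proof.
move=> df; rewrite -derive_along_line derive1E.
by apply: derivableP; exact: derivable_along_line.
Qed.

Lemma line_cvg (R : realType) (V : normedModType R) (x v : V) :
  x + s *: v @[s --> (0 : R)] --> x.
Proof.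
rewrite -[X in _ --> X]addr0 -(scale0r v).
by apply: cvgD; [exact: cvg_cst|apply: cvgZl; exact: cvg_id].
Qed.

Lemma is_derive2_along_line (R : realType) n (f : 'rV[R]_n -> R) (x : 'rV[R]_n) (i : 'I_n)
    (e := delta_mx 0 i : 'rV[R]_n) :
  (\forall y \near x, derivable f y e) -> derivable (partials [:: i] f) x e ->
  (\forall s \near (0 : R),
    is_derive (s : R) (1 : R) (fun s => f (x + s *: e)) ('D_e f (x + s *: e))) /\
  is_derive (0 : R) (1 : R) (fun s => 'D_e f (x + s *: e)) (partials [:: i; i] f x).
Proof.
move=> df ddf; split.
  near=> s; apply: is_derive_along_line; near: s; exact: line_cvg df.
have ddf' : derivable (partials [:: i] f) (x + 0 *: e) e by rewrite scale0r addr0.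
by have := is_derive_along_line ddf'; rewrite scale0r addr0.
Unshelve. all: by end_near. Qed.

(** The one-variable test applied to [f - g] along the line through [x] in direction [i]. The
    comparison is required for [y] near [x] in the whole space, with [s] read off from [y], so that
    bounds valid on a neighbourhood of [x] feed in directly. *)
Lemma partials2_le (R : realType) n (f : 'rV[R]_n -> R) (x : 'rV[R]_n) (i : 'I_n)
    (g dg : R -> R) (ddg : R) :
  (\forall y \near x, derivable f y (delta_mx 0 i)) ->
  derivable (partials [:: i] f) x (delta_mx 0 i) ->
  (forall s : R, is_derive (s : R) (1 : R) g (dg s)) -> is_derive (0 : R) (1 : R) dg ddg ->
  (\forall y \near x, forall s, y = x + s *: delta_mx 0 i -> f y - g s <= f x - g 0) ->
  partials [:: i; i] f x <= ddg.
Proof.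
move=> df ddf g1 g2 fgmax; have [f1 f2] := is_derive2_along_line df ddf.
rewrite -subr_le0; apply: (local_max_derive2_le0 (g := (fun s => f (x + s *: delta_mx 0 i)) - g)
  _ (is_deriveB f2 g2)).
  near=> s; apply: is_deriveB; last exact: g1.
  by near: s.
near=> s; rewrite -[leLHS]/(f (x + s *: delta_mx 0 i) - g s).
rewrite -[leRHS]/(f (x + 0 *: delta_mx 0 i) - g 0) scale0r addr0.
suff : forall s', x + s *: delta_mx 0 i = x + s' *: delta_mx 0 i ->
    f (x + s *: delta_mx 0 i) - g s' <= f x - g 0 by exact.
by near: s; exact: line_cvg fgmax.
Unshelve. all: by end_near. Qed.

Lemma partials2_ge0 (R : realType) n (f : 'rV[R]_n -> R) (x : 'rV[R]_n) (i : 'I_n) :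
  (\forall y \near x, derivable f y (delta_mx 0 i)) ->
  derivable (partials [:: i] f) x (delta_mx 0 i) ->
  (\forall y \near x, f x <= f y) -> 0 <= partials [:: i; i] f x.
Proof.
move=> df ddf fmin; have [f1 f2] := is_derive2_along_line df ddf.
rewrite -oppr_le0; apply: (local_max_derive2_le0 (g := - (fun s => f (x + s *: delta_mx 0 i)))
  _ (is_deriveN f2)).
  by near=> s; apply: is_deriveN; near: s.
near=> s; rewrite -[leLHS]/(- f (x + s *: delta_mx 0 i)).
rewrite -[leRHS]/(- f (x + 0 *: delta_mx 0 i)) scale0r addr0 lerN2.
by near: s; exact: line_cvg fmin.
Unshelve. all: by end_near. Qed.

(** * Geometry of the ball, normal derivatives, continuity on subsets *)

Lemma open_eball (R : realType) n (rho : R) : open (eball rho : set 'rV[R]_n).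
Proof.
rewrite (_ : eball rho = @enorm R n @^-1` [set r | r < rho])//.
by apply: open_comp; [move=> x _; exact: enorm_continuous|exact: open_lt].
Qed.

Lemma sqr_enorm_line (R : realType) n (x : 'rV[R]_n) (i : 'I_n) (s : R) :
  enorm (x + s *: delta_mx 0 i) ^+ 2 = enorm x ^+ 2 + 2 * s * x 0 i + s ^+ 2.
Proof.
rewrite !sqr_enorm !(bigD1 (P := predT) i)//= !mxE !eqxx mulr1.
rewrite (eq_bigr (fun j => x 0 j ^+ 2)); first by ring.
by move=> j ji; rewrite !mxE eqxx (negbTE ji) mulr0 addr0.
Qed.

Lemma enorm_inward (R : realType) n (rho h : R) (x : 'rV[R]_n) :
  0 < rho -> 0 < h < rho -> enorm x = rho ->
  enorm (x - h *: (rho^-1 *: x)) = rho - h.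
Proof.
move=> rho0 /andP[h0 hrho] xrho.
rewrite -{1}[x]scale1r scalerA -scalerBl enormZ xrho ger0_norm; first by field; rewrite gt_eqF.
by rewrite subr_ge0 ler_pdivrMr// mul1r ltW.
Qed.

Lemma has_normal_derivative_gt (R : realType) n (rho : R) (f : 'rV[R]_n -> R)
    (x : 'rV[R]_n) (d k : R) :
  has_normal_derivative rho f x d -> k < d ->
  exists2 e, 0 < e & forall h, 0 < h < e ->
    k * h < f x - f (x - h *: (rho^-1 *: x)).
Proof.
move=> /cvgr_gt fd /fd /near_right0P[e e0 eP]; exists e => // h he.
by rewrite -ltr_pdivlMr ?eP//; case/andP: he.
Qed.

Lemma within_continuous_comp (X Y Z : topologicalType) (A : set X) (B : set Y)
    (f : Y -> Z) (h : X -> Y) :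
  {within B, continuous f} -> continuous h -> (forall x, A x -> B (h x)) ->
  {within A, continuous (f \o h)}.
Proof.
move=> /subspace_continuousP fc hc AB; apply/subspace_continuousP => x Ax.
apply: cvg_comp (fc _ (AB _ Ax)) => S; rewrite /within/= /nbhs/= => BS.
have := hc x _ BS; rewrite /nbhs/=; apply: filterS => y /= yS /AB; exact: yS.
Qed.

Lemma pair_continuous (X Y Z : topologicalType) (f : X -> Y) (g : X -> Z) :
  continuous f -> continuous g -> continuous (fun x => (f x, g x)).
Proof. by move=> fc gc x; apply: cvg_pair; [exact: fc|exact: gc]. Qed.

Lemma within_continuous_slice (X Y Z : topologicalType) (A : set X) (B : set Y)
    (f : X * Y -> Z) (x : X) :
  {within A `*` B, continuous f} -> A x -> {within B, continuous (fun y => f (x, y))}.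
Proof.
move=> fc Ax; apply: (within_continuous_comp (h := pair x) fc) => //.
by apply: pair_continuous => y; [exact: cvg_cst|exact: cvg_id].
Qed.

(** * The barrier and its contact with a solution *)

(** With [a] equal to |x|^2 - rho^2 and [b] the i-th coordinate of x, this function is the
    restriction of exp(N (|x|^2 - rho^2)) to the line x + s e_i. *)
Lemma gaussian_line_derive (R : realType) (N a b : R) (s : R) :
  is_derive (s : R) (1 : R) (fun s => expR (N * (a + 2 * s * b + s ^+ 2)))
    (N * (2 * b + 2 * s) * expR (N * (a + 2 * s * b + s ^+ 2))).
Proof.
have : is_derive (s : R) (1 : R) (fun s => N * (a + 2 * s * b + s ^+ 2)) (N * (2 * b + 2 * s)).
  apply: is_derive_eq; rewrite /GRing.scale/=; ring.
move=> H; rewrite mulrC.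
by have := @is_derive1_comp R expR _ _ _ _ (is_derive_expR _) H.
Qed.

Lemma gaussian_line_derive2 (R : realType) (N a b : R) :
  is_derive (0 : R) (1 : R)
    (fun s => N * (2 * b + 2 * s) * expR (N * (a + 2 * s * b + s ^+ 2)))
    ((2 * N + 4 * N ^+ 2 * b ^+ 2) * expR (N * a)).
Proof.
have H1 := @gaussian_line_derive R N a b 0.
have : is_derive (0 : R) (1 : R) (fun s => N * (2 * b + 2 * s)) (2 * N).
  apply: is_derive_eq; rewrite /GRing.scale/=; ring.
move=> H2; have := @is_deriveM _ _ _ _ _ _ _ _ H2 H1.
set d := (X in is_derive _ _ _ X); suff -> : d = (2 * N + 4 * N ^+ 2 * b ^+ 2) * expR (N * a) by [].
rewrite /d /GRing.scale/= mulr0 !mul0r expr0n/= !addr0; ring.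
Qed.

Lemma solution_interior (R : realType) n (rho p q lambda T : R)
    (u0 : 'rV[R]_n -> R) (u : 'rV[R]_n -> R -> R) (x : 'rV[R]_n) (t : R) :
  classical_solution rho p q lambda T u0 u -> eball rho x -> 0 < t < T ->
  [/\ derivable (u x) t 1,
      derive1 (u x) t = laplacian (u ^~ t) x + lambda * expR (p * u x t) &
      forall i, (\forall y \near x, derivable (u ^~ t) y (delta_mx 0 i)) /\
        derivable (partials [:: i] (u ^~ t)) x (delta_mx 0 i)].
Proof.
move=> [[reg _ _] pde _ _] xrho tT; have [_ _ dt _] := reg _ _ xrho tT.
split => //; first exact: pde.
move=> i; split; last by have [_ /(_ [:: i] i isT) ] := reg _ _ xrho tT.
near=> y; have yrho : eball rho y by near: y; exact: open_nbhs_nbhs (conj (@open_eball _ _ _) _).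
by have [_ /(_ [::] i isT) ] := reg _ _ yrho tT.
Unshelve. all: by end_near. Qed.

Lemma eball_ecball (R : realType) n (rho : R) : eball rho `<=` (ecball rho : set 'rV[R]_n).
Proof. by move=> x /ltW. Qed.

(** [m] bounds the solution at time [t0]; [N] makes the barrier steep at the sphere, where its
    normal slope is 2 N rho; [B] is its upward speed in time. *)
Definition barrier (R : realType) n (rho m N B t0 : R) (x : 'rV[R]_n) (t : R) : R :=
  m + expR (N * (enorm x ^+ 2 - rho ^+ 2)) + B * (t - t0).

Lemma barrier_continuous (R : realType) n (rho m N B t0 : R) :
  continuous (fun z : 'rV[R]_n * R => barrier rho m N B t0 z.1 z.2).
Proof.
have gc : continuous (fun r : R => expR (N * (r ^+ 2 - rho ^+ 2))).
  by move=> r; apply/differentiable_continuous/derivable1_diffP.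
have cfst : continuous (fun z : 'rV[R]_n * R => enorm z.1).
  by move=> z; apply: (@continuous_comp _ _ _ fst (@enorm R n));
    [exact: cvg_fst|exact: enorm_continuous].
have tc : continuous (fun t : R => B * (t - t0)).
  by move=> r; apply/differentiable_continuous/derivable1_diffP.
have h1 : continuous (fun z : 'rV[R]_n * R => expR (N * (enorm z.1 ^+ 2 - rho ^+ 2))).
  by move=> z; apply: (@continuous_comp _ _ _ (fun z : 'rV[R]_n * R => enorm z.1)
    (fun r : R => expR (N * (r ^+ 2 - rho ^+ 2)))); [exact: cfst|exact: gc].
have h2 : continuous (fun z : 'rV[R]_n * R => B * (z.2 - t0)).
  by move=> z; apply: (@continuous_comp _ _ _ snd (fun t : R => B * (t - t0)));
    [exact: cvg_snd|exact: tc].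
move=> z; apply: (cvgD (cvgD _ (h1 z)) (h2 z)); exact: cvg_cst.
Qed.

(** In the closed ball the exponential lies in (0, 1], and [B * (t - t0)] lies in [0, 1]; hence the
    strict lower bound and the 2. *)
Lemma barrier_bounds (R : realType) n (rho m N B t0 t1 t : R) (x : 'rV[R]_n) :
  0 < N -> 0 < B -> B * (t1 - t0) <= 1 -> t0 <= t <= t1 -> ecball rho x ->
  m < barrier rho m N B t0 x t <= m + 2.
Proof.
move=> N0 B0 Bt /andP[t0t tt1] xrho; rewrite /barrier.
have -> /= : m < m + expR (N * (enorm x ^+ 2 - rho ^+ 2)) + B * (t - t0).
  have := expR_gt0 (N * (enorm x ^+ 2 - rho ^+ 2)).
  have : 0 <= B * (t - t0) by apply: mulr_ge0; lra.
  lra.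
have : expR (N * (enorm x ^+ 2 - rho ^+ 2)) <= 1.
  rewrite -expR0 ler_expR pmulr_rle0// subr_le0 lerXn2r// nnegrE.
  - exact: enorm_ge0.
  - exact: le_trans (enorm_ge0 _) xrho.
have : B * (t - t0) <= B * (t1 - t0) by apply: ler_wpM2l; lra.
lra.
Qed.

(** The points of the cylinder where [u] is at least the barrier form a nonempty compact set; one
    with least time coordinate is taken. Its time exceeds [t0] because the barrier is strictly above
    [m] there. *)
Lemma barrier_first_contact (R : realType) n (rho m N B t0 t1 : R)
    (u : 'rV[R]_n -> R -> R) (x1 : 'rV[R]_n) (s1 : R) :
  {within ecball rho `*` [set` `[t0, t1]], continuous (fun z => u z.1 z.2)} ->
  0 < N -> 0 < B -> B * (t1 - t0) <= 1 ->
  (forall x, ecball rho x -> u x t0 <= m) ->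
  ecball rho x1 -> t0 <= s1 <= t1 -> barrier rho m N B t0 x1 s1 <= u x1 s1 ->
  exists x t, [/\ ecball rho x, t0 < t <= t1, u x t = barrier rho m N B t0 x t,
    (forall y, ecball rho y -> u y t <= barrier rho m N B t0 y t) &
    forall s, t0 <= s < t -> u x s < barrier rho m N B t0 x s].
Proof.
move=> uc N0 B0 Bt um x1rho s1t us1.
pose w (z : 'rV[R]_n * R) := u z.1 z.2 - barrier rho m N B t0 z.1 z.2.
pose K : set ('rV[R]_n * R) := ecball rho `*` [set` `[t0, t1]].
have wc : {within K, continuous w}.
  move=> z; apply: cvgB; first exact: uc.
  by apply: (@continuous_subspaceT _ _ K); exact: barrier_continuous.
have Kco : compact K by apply: compact_setX; [exact: compact_ecball|exact: segment_compact].
have Kcl : closed K by apply: (compact_closed _ Kco); exact: norm_hausdorff.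
have Sco := @compact_superlevel _ _ K w 0 Kcl Kco wc.
have S1 : (K `&` [set z | 0 <= w z]) (x1, s1).
  by split; [split => //=; rewrite in_itv|rewrite /= /w/= subr_ge0].
have [|[x t] /[!inE] -[[/= xrho]] ] := @compact_EVT_min _ _ (@snd 'rV[R]_n R) _ (ex_intro _ _ S1) Sco.
  by apply: continuous_subspaceT => z; exact: cvg_snd.
rewrite in_itv/= => /andP[t0t tt1] wxt tmin.
have before y s : ecball rho y -> t0 <= s < t -> w (y, s) < 0.
  move=> yrho /andP[t0s st]; rewrite ltNge; apply/negP => wys.
  have /(tmin _)/= : (y, s) \in K `&` [set z | 0 <= w z].
    by rewrite inE; split => //; split => //=; rewrite in_itv/= t0s ltW// (lt_le_trans st).
  by rewrite leNgt st.
have start y : ecball rho y -> w (y, t0) < 0.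
  move=> yrho; rewrite /w/= subr_lt0 (le_lt_trans (um _ yrho))//.
  have t0t0 : t0 <= t0 <= t1 by rewrite lexx (le_trans t0t).
  by have /andP[] := barrier_bounds m N0 B0 Bt t0t0 yrho.
have {}t0t : t0 < t.
  rewrite lt_neqAle t0t andbT; apply/eqP => t0E.
  by have := start _ xrho; rewrite t0E ltNge wxt.
(* No point may already be strictly above the barrier at time [t]: going back in time, [w] would
   vanish strictly before [t] by the intermediate value theorem. *)
have at_t y : ecball rho y -> w (y, t) <= 0.
  move=> yrho; rewrite leNgt; apply/negP => wyt.
  have wyc : {within [set` `[t0, t]], continuous (fun s => w (y, s))}.
    apply: continuous_subspaceW (within_continuous_slice wc yrho).
    move=> s /=; rewrite !in_itv/= => /andP[-> st]; exact: le_trans st tt1.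
  have [|c] := IVT (ltW t0t) wyc (v := 0).
    by rewrite ge_min le_max (ltW wyt) (ltW (start _ yrho)) orbT.
  rewrite in_itv/= => /andP[t0c]; rewrite le_eqVlt => /orP[/eqP->|ct] wyc0.
    by move: wyt; rewrite wyc0 ltxx.
  by have := before y c yrho; rewrite t0c ct wyc0 ltxx => /(_ isT).
exists x, t; split => //.
- by rewrite t0t.
- by apply/eqP; rewrite -subr_eq0 -/(w (x, t)) eq_le at_t.
- by move=> y /at_t; rewrite /w/= subr_le0.
- by move=> s /(before _ _ xrho); rewrite /w/= subr_lt0.
Qed.

Lemma has_normal_derivative_lt (R : realType) n (rho : R) (f : 'rV[R]_n -> R)
    (x : 'rV[R]_n) (d k : R) :
  has_normal_derivative rho f x d -> d < k ->
  exists2 e, 0 < e & forall h, 0 < h < e ->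
    f x - f (x - h *: (rho^-1 *: x)) < k * h.
Proof.
move=> /cvgr_lt fd /fd /near_right0P[e e0 eP]; exists e => // h he.
by rewrite -ltr_pdivrMr ?eP//; case/andP: he.
Qed.

(** The barrier touches [f] from above at [x], so it dominates each pure second partial there; its
    own are (2 N + 4 N^2 x_i^2) times an exponential at most 1, and the squares x_i^2 sum to at most
    rho^2. *)
Lemma laplacian_barrier_contact (R : realType) n (rho m N B t0 t : R)
    (f : 'rV[R]_n -> R) (x : 'rV[R]_n) :
  0 < N -> eball rho x ->
  (forall i, (\forall y \near x, derivable f y (delta_mx 0 i)) /\
        derivable (partials [:: i] f) x (delta_mx 0 i)) ->
  f x = barrier rho m N B t0 x t ->
  (forall y, ecball rho y -> f y <= barrier rho m N B t0 y t) ->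
  laplacian f x <= 2 * N * n%:R + 4 * N ^+ 2 * rho ^+ 2.
Proof.
move=> N0 xrho freg fxE fle; set a := enorm x ^+ 2 - rho ^+ 2.
have x2 : enorm x ^+ 2 <= rho ^+ 2.
  rewrite lerXn2r ?nnegrE ?enorm_ge0//; last exact: ltW.
  by rewrite (le_trans (enorm_ge0 x))// ltW.
have E1 : expR (N * a) <= 1 by rewrite -expR0 ler_expR pmulr_rle0// subr_le0.
have part i : partials [:: i; i] f x <= 2 * N + 4 * N ^+ 2 * x 0 i ^+ 2.
  have [freg1 freg2] := freg i.
  apply: (@le_trans _ _ ((2 * N + 4 * N ^+ 2 * x 0 i ^+ 2) * expR (N * a))); last first.
    have sq0 : 0 <= 4 * N ^+ 2 * x 0 i ^+ 2 by rewrite -mulrA -exprMn mulr_ge0 ?sqr_ge0.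
    by rewrite ler_piMr//; lra.
  apply: (partials2_le freg1 freg2 (gaussian_line_derive N a (x 0 i))
    (gaussian_line_derive2 N a (x 0 i))).
  near=> y => s yE.
  have yrho : ecball rho y.
    by apply: eball_ecball; near: y; exact: open_nbhs_nbhs (conj (@open_eball _ _ _) _).
  have yn : enorm y ^+ 2 - rho ^+ 2 = a + 2 * s * x 0 i + s ^+ 2.
    by rewrite yE sqr_enorm_line /a; ring.
  have := fle _ yrho; rewrite fxE /barrier yn -/a mulr0 mul0r !addr0 expr0n/= addr0; lra.
apply: le_trans (ler_sum _ (fun i _ => part i)) _.
rewrite big_split/= sumr_const card_ord -mulr_sumr -sqr_enorm mulr_natr lerD2l.
by apply: ler_wpM2l => //; rewrite mulr_ge0 ?sqr_ge0.
Unshelve. all: by end_near. Qed.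

(** Moving inward by a small [h], the barrier drops by at least [N * rho / 2 * h] while [f] drops by
    less, so [f] would exceed the barrier just inside the sphere. *)
Lemma barrier_contact_boundary (R : realType) n (rho m N B t0 t d : R)
    (f : 'rV[R]_n -> R) (x : 'rV[R]_n) :
  0 < rho -> 0 < N -> enorm x = rho ->
  has_normal_derivative rho f x d -> d < N * rho / 2 ->
  f x = barrier rho m N B t0 x t ->
  ~ (forall y, ecball rho y -> f y <= barrier rho m N B t0 y t).
Proof.
move=> rho0 N0 xrho fd dN fxE fle.
have [e e0 eP] := has_normal_derivative_lt fd dN.
have [h [h0 he hrho hN]] : exists h, [/\ 0 < h, h < e, h < rho & N * rho * h <= 1].
  (* The last constraint, [N * rho * h <= 1], is what permits exp(-b) <= 1 - b/2 for b = N rho h. *)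
  exists (Num.min (Num.min e rho) (N * rho)^-1 / 2).
  have NV : 0 < (N * rho)^-1 by rewrite invr_gt0 mulr_gt0.
  have me : Num.min (Num.min e rho) (N * rho)^-1 <= e by rewrite !ge_min lexx.
  have mr : Num.min (Num.min e rho) (N * rho)^-1 <= rho by rewrite !ge_min lexx orbT.
  have mN : Num.min (Num.min e rho) (N * rho)^-1 <= (N * rho)^-1 by rewrite !ge_min lexx orbT.
  have m0 : 0 < Num.min (Num.min e rho) (N * rho)^-1 by rewrite !lt_min e0 rho0.
  split; try lra.
  by rewrite -ler_pdivlMl ?mulr_gt0// mulr1; lra.
have hlt : 0 < h < e by rewrite h0.
have xh : enorm (x - h *: (rho^-1 *: x)) = rho - h by apply: enorm_inward; rewrite ?h0.
have fxh := fle (x - h *: (rho^-1 *: x)).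
have {}fxh := fxh (ltac:(rewrite /ecball/= xh; lra)).
have := eP _ hlt; apply/negP; rewrite -leNgt fxE.
apply: le_trans (lerB (lexx _) fxh).
rewrite /barrier xh xrho subrr mulr0 expR0.
set b := N * rho * h in hN *.
have b0 : 0 < b by rewrite !mulr_gt0.
have : expR (N * ((rho - h) ^+ 2 - rho ^+ 2)) <= expR (- b).
  rewrite ler_expR -subr_ge0 /b (_ : _ - _ = N * (h * (rho - h))); last by ring.
  by rewrite !mulr_ge0 ?subr_ge0 ?ltW.
(* Follows from exp(b) >= 1 + b and (1 + b)(1 - b/2) >= 1 for 0 <= b <= 1. *)
have : expR (- b) <= 1 - b / 2.
  rewrite expRN invf_ple ?posrE ?expR_gt0//; last by lra.
  apply: le_trans (expR_ge1Dx b).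
  by rewrite -[leLHS]mulr1 ler_pdivrMl; [nra|lra].
by rewrite (_ : N * rho / 2 * h = b / 2); [lra|rewrite /b; field].
Qed.

(** At a first contact with the barrier, the lower bound on [N] excludes a point of the sphere
    through the flux condition, and the lower bound on [B] excludes an interior point through the
    equation. *)
Lemma supersolution_bound (R : realType) n (rho p q lambda T m N B t0 t1 : R)
    (u0 : 'rV[R]_n -> R) (u : 'rV[R]_n -> R -> R) :
  0 < rho -> 0 < p -> 0 < q -> 0 < lambda ->
  classical_solution rho p q lambda T u0 u ->
  0 <= t0 -> t1 < T -> 0 < N -> 0 < B -> B * (t1 - t0) <= 1 ->
  expR (q * (m + 2)) < N * rho / 2 ->
  2 * N * n%:R + 4 * N ^+ 2 * rho ^+ 2 + lambda * expR (p * (m + 2)) < B ->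
  (forall x, ecball rho x -> u x t0 <= m) ->
  forall x t, ecball rho x -> t0 <= t <= t1 -> u x t <= m + 2.
Proof.
move=> rho0 p0 q0 lambda0 sol t00 t1T N0 B0 Bt Nbig Bbig um x1 s1 x1rho s1t.
have [|contact] := ltP (u x1 s1) (barrier rho m N B t0 x1 s1).
  by have := barrier_bounds m N0 B0 Bt s1t x1rho; lra.
have [[_ _ ucont] _ bc _] := sol.
have uc : {within ecball rho `*` [set` `[t0, t1]], continuous (fun z => u z.1 z.2)}.
  apply: continuous_subspaceW ucont => -[x t] /= []; rewrite in_itv/= => xrho /andP[t0t tt1].
  by split => //=; rewrite (le_trans t00)//= (le_lt_trans tt1).
have [x [t [xrho /andP[t0t tt1] uE ule ubefore]]] :=
  barrier_first_contact uc N0 B0 Bt um x1rho s1t contact.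
have tT : 0 < t < T by rewrite (le_lt_trans t00 t0t) (le_lt_trans tt1).
have tin : t0 <= t <= t1 by rewrite ltW.
have ubd : u x t <= m + 2.
  by rewrite uE; have /andP[] := barrier_bounds m N0 B0 Bt tin xrho.
have [xin|] := ltP (enorm x) rho; last first.
  move=> xge; have xE : enorm x = rho by apply/eqP; rewrite eq_le xge andbT.
  exfalso; apply: (@barrier_contact_boundary _ _ rho m N B t0 t (expR (q * u x t)) (u ^~ t) x) => //.
    exact: bc.
  by apply: le_lt_trans Nbig; rewrite ler_expR ler_wpM2l// ltW.
have [dt pde reg2] := solution_interior sol xin tT.
have lap := laplacian_barrier_contact N0 xin reg2 uE ule.
(* Before the contact [u x] stays below a function affine in time with slope [B], and meets it at
   [t]; so [u x s - B * s] has a left maximum at [t]. *)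
have ut : B <= derive1 (u x) t.
  have dB : is_derive (t : R) (1 : R) (fun s => B * s) B.
    by apply: is_derive_eq; rewrite /GRing.scale/=; ring.
  have dg := is_deriveB (derivableP dt) dB.
  rewrite derive1E -subr_ge0 -(@derive_val _ _ _ _ _ _ _ dg) -derive1E.
  apply: left_max_derive1_ge0; first exact: (@ex_derive _ _ _ _ _ _ _ dg).
  near=> s.
  have : t0 <= s < t by apply/andP; split; near: s; [exact: nbhs_left_ge|exact: nbhs_left_lt].
  move=> /ubefore; rewrite -[leLHS]/(u x s - B * s) -[leRHS]/(u x t - B * t) uE /barrier.
  lra.
have : expR (p * u x t) <= expR (p * (m + 2)) by rewrite ler_expR ler_wpM2l// ltW.
move=> /(ler_wpM2l (ltW lambda0)).
move: ut; rewrite pde; lra.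
Unshelve. all: by end_near. Qed.

(** * Preservation of monotonicity in the radius *)

(** The initial condition is given on the open ball only; continuity along the rays s z, as s tends
    to 1 from the left, carries the inequality to the sphere. *)
Lemma initial_nondecreasing (R : realType) n (rho T : R)
    (u0 : 'rV[R]_n -> R) (u : 'rV[R]_n -> R -> R) :
  0 < rho -> 0 < T -> 
  {within ecball rho `*` [set t | 0 <= t < T], continuous (fun z => u z.1 z.2)} ->
  (forall x, eball rho x -> u x 0 = u0 x) ->
  (forall x y, ecball rho x -> ecball rho y -> enorm x <= enorm y -> u0 x <= u0 y) ->
  forall x y, ecball rho x -> ecball rho y -> enorm x <= enorm y -> u x 0 <= u y 0.
Proof.
move=> rho0 T0 uc init u0mono x y xrho yrho xy.
have scale (z : 'rV[R]_n) (s : R) : ecball rho z -> s \in `[0, 1] ->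
    ecball rho (s *: z) /\ (s < 1 -> eball rho (s *: z)).
  rewrite in_itv/= => zrho /andP[s0 s1]; rewrite /ecball/eball/= enormZ ger0_norm//.
  have := enorm_ge0 z; have : enorm z <= rho by [].
  by split => [|?]; nra.
have rc (z : 'rV[R]_n) : ecball rho z -> {within `[0, 1], continuous (fun s : R => u (s *: z) 0)}.
  move=> zrho; apply: (@within_continuous_comp _ _ _ _ _ (fun z : 'rV[R]_n * R => u z.1 z.2)
    (fun s : R => (s *: z, 0 : R)) uc).
    by apply: pair_continuous; [exact: scalel_continuous|exact: cst_continuous].
  by move=> s /= s01; split; [have [] := scale z s zrho s01|rewrite /= lexx].
have ray (z : 'rV[R]_n) : ecball rho z -> u (s *: z) 0 @[s --> 1^'-] --> u z 0.
  move=> /rc /(continuous_within_itvP _ (@ltr01 R))[_ _].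
  by rewrite scale1r.
rewrite -subr_ge0; apply: (cvgr_to_ge (cvgB (ray _ yrho) (ray _ xrho))).
near=> s; have s01 : s \in `[0, 1].
  rewrite in_itv/=; apply/andP; split; near: s; [exact: nbhs_left_ge|exact: nbhs_left_le].
have s1 : s < 1 by near: s; exact: nbhs_left_lt.
have [sx /(_ s1) sx'] := scale x s xrho s01.
have [sy /(_ s1) sy'] := scale y s yrho s01.
rewrite -[leRHS]/(u (s *: y) 0 - u (s *: x) 0) subr_ge0 !init//.
by apply: u0mono => //; rewrite !enormZ ler_wpM2l.
Unshelve. all: by end_near. Qed.

(** The graph of [expR] lies above its tangent at [a]. *)
Lemma expR_sub_le (R : realType) (a b : R) : expR a - expR b <= expR a * (a - b).
Proof.
have := ler_wpM2l (ltW (expR_gt0 a)) (expR_ge1Dx (b - a)).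
by rewrite -expRD (addrC a) subrK; lra.
Qed.

Lemma solution_radially_nondecreasing (R : realType) n (rho p q lambda T t1 : R)
    (u0 : 'rV[R]_n -> R) (u : 'rV[R]_n -> R -> R) :
  0 < rho -> 0 < p -> 0 < lambda -> classical_solution rho p q lambda T u0 u ->
  (forall t, 0 <= t < T -> radial_on (ecball rho) (u ^~ t)) ->
  (forall x y, ecball rho x -> ecball rho y -> enorm x <= enorm y -> u x 0 <= u y 0) ->
  0 <= t1 < T ->
  forall x y, ecball rho x -> ecball rho y -> enorm x <= enorm y -> u x t1 <= u y t1.
Proof.
move=> rho0 p0 lambda0 sol urad mono0 /andP[t10 t1T] x1 y1 x1rho y1rho xy1.
rewrite leNgt; apply/negP => u1.
have [[_ _ ucont] _ bc _] := sol.
pose K0 : set ('rV[R]_n * R) := ecball rho `*` [set` `[0, t1]].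
have uc : {within K0, continuous (fun z => u z.1 z.2)}.
  apply: continuous_subspaceW ucont => -[x t] [/= xrho]; rewrite in_itv/= => /andP[t0 tt1].
  by split => //=; rewrite t0 (le_lt_trans tt1).
have K0co : compact K0 by apply: compact_setX; [exact: compact_ecball|exact: segment_compact].
have t1in : t1 \in `[0, t1] by rewrite in_itv/= t10 lexx.
have K0ne : K0 !=set0 by exists (x1, t1).
have [zA _ uA] := compact_EVT_max K0ne K0co uc.
set A := u zA.1 zA.2 in uA.
have {}uA x t : ecball rho x -> 0 <= t <= t1 -> u x t <= A.
  move=> xrho t01; have K0xt : K0 (x, t) by split => //=; rewrite in_itv.
  exact: uA (mem_set K0xt).
(* [L] is a Lipschitz constant of the reaction term for values at most [A]; the extra 1 in [k] makes
   the final inequality strict. *)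
pose L := lambda * (p * expR (p * A)).
pose k := L + 1.
pose G (z : 'rV[R]_n * 'rV[R]_n * R) := expR (- k * z.2) * (u z.1.1 z.2 - u z.1.2 z.2).
pose K1 : set ('rV[R]_n * 'rV[R]_n * R) := (ecball rho `*` ecball rho) `*` [set` `[0, t1]].
have c11 : continuous (fun z : 'rV[R]_n * 'rV[R]_n * R => z.1.1).
  by move=> z; apply: (cvg_comp (@fst _ _) (@fst _ _)); [exact: cvg_fst|exact: cvg_fst].
have c12 : continuous (fun z : 'rV[R]_n * 'rV[R]_n * R => z.1.2).
  by move=> z; apply: (cvg_comp (@fst _ _) (@snd _ _)); [exact: cvg_fst|exact: cvg_snd].
have Gc : {within K1, continuous G}.
  have cx : {within K1, continuous (fun z => u z.1.1 z.2)}.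
    apply: (@within_continuous_comp _ _ _ _ _ (fun z : 'rV[R]_n * R => u z.1 z.2)
      (fun z : 'rV[R]_n * 'rV[R]_n * R => (z.1.1, z.2)) uc).
      by apply: pair_continuous => // z; exact: cvg_snd.
    by move=> -[[x y] t] [[]].
  have cy : {within K1, continuous (fun z => u z.1.2 z.2)}.
    apply: (@within_continuous_comp _ _ _ _ _ (fun z : 'rV[R]_n * R => u z.1 z.2)
      (fun z : 'rV[R]_n * 'rV[R]_n * R => (z.1.2, z.2)) uc).
      by apply: pair_continuous => // z; exact: cvg_snd.
    by move=> -[[x y] t] [[]].
  have ce : {within K1, continuous (fun z => expR (- k * z.2))}.
    apply: continuous_subspaceT => z.
    apply: (@continuous_comp _ _ _ snd (fun t : R => expR (- k * t))); first exact: cvg_snd.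
    by apply/differentiable_continuous/derivable1_diffP.
  by move=> z; apply: (cvgM (ce z)); apply: cvgB; [exact: cx|exact: cy].
have K1co : compact K1.
  by do 2?[apply: compact_setX]; [exact: compact_ecball|exact: compact_ecball|exact: segment_compact].
have K1cl : closed K1 by apply: (compact_closed _ K1co); exact: norm_hausdorff.
have dc : {within K1, continuous (fun z => enorm z.1.2 - enorm z.1.1)}.
  have e1 : continuous (fun z : 'rV[R]_n * 'rV[R]_n * R => enorm z.1.1).
    by move=> z; exact: (continuous_comp (c11 z) (@enorm_continuous R n _)).
  have e2 : continuous (fun z : 'rV[R]_n * 'rV[R]_n * R => enorm z.1.2).
    by move=> z; exact: (continuous_comp (c12 z) (@enorm_continuous R n _)).
  by apply: continuous_subspaceT => z; exact: (cvgB (e2 z) (e1 z)).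
have Kco := @compact_superlevel _ _ K1 _ 0 K1cl K1co dc.
set K := K1 `&` _ in Kco.
have GcK : {within K, continuous G}.
  by apply: continuous_subspaceW Gc => z [].
have Kin : K ((x1, y1), t1) by split => //=; rewrite subr_ge0.
have [[[x y] t] /[!inE] -[[[/= xrho yrho]]]] := compact_EVT_max (ex_intro _ _ Kin) Kco GcK.
rewrite in_itv/= subr_ge0 => /andP[t0 tt1] xy Gmax.
have {}Gmax x' y' t' : ecball rho x' -> ecball rho y' -> 0 <= t' <= t1 ->
    enorm x' <= enorm y' -> G ((x', y'), t') <= G ((x, y), t).
  move=> x'rho y'rho t'01 xy'; apply: Gmax; rewrite inE; split; last by rewrite /= subr_ge0.
  by split => //=; rewrite in_itv.
have diff_gt0 : 0 < u x t - u y t.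
  have : 0 < G ((x, y), t).
    apply: lt_le_trans (Gmax _ _ t1 x1rho y1rho _ xy1); last by rewrite t10 lexx.
    by rewrite mulr_gt0 ?expR_gt0// subr_gt0.
  by rewrite pmulr_rgt0// expR_gt0.
have tT : t < T := le_lt_trans tt1 t1T.
have {}t0 : 0 < t.
  rewrite lt_neqAle t0 andbT; apply/eqP => t0E.
  by move: diff_gt0; rewrite -t0E subr_gt0 ltNge mono0.
have t01 : 0 <= t <= t1 by rewrite ltW.
have t0T : 0 < t < T by rewrite t0.
have {}xy : enorm x < enorm y.
  rewrite lt_neqAle xy andbT; apply/eqP => xyE.
  have := urad t _ x y xrho yrho xyE; rewrite ltW//= => /(_ tT) uE.
  by move: diff_gt0; rewrite uE subrr ltxx.
(* Freezing one of the two points in the maximality of [G] splits it into a minimum at [y] and a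
   maximum at [x]. Since now |x| < |y|, both become local extrema once the points are known to be
   interior. *)
have ymin y' : ecball rho y' -> enorm x <= enorm y' -> u y t <= u y' t.
  move=> y'rho xy'; have := Gmax x y' t xrho y'rho t01 xy'.
  by rewrite /G/= ler_pM2l ?expR_gt0// lerD2l lerN2.
have xmax x' : enorm x' <= enorm y -> u x' t <= u x t.
  move=> xy'; have := Gmax x' y t (le_trans xy' yrho) yrho t01 xy'.
  by rewrite /G/= ler_pM2l ?expR_gt0// lerD2r.
have xin : eball rho x := lt_le_trans xy yrho.
(* On the sphere, the positive flux would make [u] smaller slightly inside, at radius [rho - h],
   still larger than |x|; this contradicts [ymin]. *)
have yin : eball rho y.
  rewrite /eball/= lt_neqAle yrho andbT; apply/eqP => yE.
  have [e e0 eP] := has_normal_derivative_gt (bc y t yE t0T) (expR_gt0 _).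
  pose h := Num.min e (rho - enorm x) / 2.
  have [h0 he hx] : [/\ 0 < h, h < e & h < rho - enorm x].
    have m1 : Num.min e (rho - enorm x) <= e by rewrite ge_min lexx.
    have m2 : Num.min e (rho - enorm x) <= rho - enorm x by rewrite ge_min lexx orbT.
    have m0 : 0 < Num.min e (rho - enorm x) by rewrite lt_min e0 subr_gt0.
    by rewrite /h; split; lra.
  have hrho : 0 < h < rho by rewrite h0; have := enorm_ge0 x; lra.
  have yh := enorm_inward rho0 hrho yE.
  have : 0 < h < e by rewrite h0.
  move=> /eP; rewrite mul0r subr_gt0 ltNge => /negP; apply; apply: ymin.
    by rewrite /ecball/= yh; lra.
  by rewrite yh; lra.
have [dx pdex regx] := solution_interior sol xin t0T.
have [dy pdey regy] := solution_interior sol yin t0T.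
have lapx : laplacian (u ^~ t) x <= 0.
  apply: sumr_le0 => i _; have [r1 r2] := regx i.
  have d0 (s : R) : is_derive (s : R) (1 : R) (fun=> 0 : R) 0 by exact: is_derive_cst.
  apply: (partials2_le r1 r2 d0 (d0 0)).
  near=> x' => s _; rewrite !subr0; apply: xmax; apply: eball_ecball.
  by near: x'; exact: open_nbhs_nbhs (conj (@open_eball _ _ _) _).
have lapy : 0 <= laplacian (u ^~ t) y.
  apply: sumr_ge0 => i _; have [r1 r2] := regy i.
  apply: (partials2_ge0 r1 r2); near=> y'; apply: ymin.
    by apply: eball_ecball; near: y'; exact: open_nbhs_nbhs (conj (@open_eball _ _ _) _).
  apply/ltW; near: y'; exact: (cvgr_gt _ (@enorm_continuous R n y) _ xy).
have dG : is_derive (t : R) (1 : R) (fun s => G ((x, y), s))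
    (expR (- k * t) * (derive1 (u x) t - derive1 (u y) t - k * (u x t - u y t))).
  have de : is_derive (t : R) (1 : R) (fun s => expR (- k * s)) (expR (- k * t) * - k).
    apply: (@is_derive1_comp R expR _ _ _ _ (is_derive_expR _)).
    by apply: is_derive_eq; rewrite /GRing.scale/=; ring.
  have := is_deriveM de (is_deriveB (derivableP dx) (derivableP dy)).
  rewrite -!derive1E; set d := (X in is_derive _ _ _ X).
  suff -> : d = expR (- k * t) * (derive1 (u x) t - derive1 (u y) t - k * (u x t - u y t)) by [].
  by rewrite /d -[(u x - u y) t]/(u x t - u y t) /GRing.scale/=; ring.
have : 0 <= derive1 (fun s => G ((x, y), s)) t.
  apply: left_max_derive1_ge0; first exact: (@ex_derive _ _ _ _ _ _ _ dG).
  near=> s; apply: Gmax => //; last exact: ltW.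
  apply/andP; split; first by near: s; exact: nbhs_left_ge.
  by apply: le_trans tt1; near: s; exact: nbhs_left_le.
rewrite derive1E (@derive_val _ _ _ _ _ _ _ dG) pmulr_rge0 ?expR_gt0// pdex pdey subr_ge0.
apply/negP; rewrite -ltNge.
(* The equation and the signs of the two Laplacians bound the difference of the time derivatives by
   the left-hand side, while the time derivative of [G] requires it to be at least k (u(x,t) -
   u(y,t)). *)
have exps : lambda * (expR (p * u x t) - expR (p * u y t)) <= L * (u x t - u y t).
  rewrite /L -mulrA ler_pM2l// (le_trans (expR_sub_le _ _))// -mulrBr mulrCA mulrA.
  rewrite ler_pM2r// ler_pM2l// ler_expR ler_pM2l//; exact: uA.
by rewrite /k mulrDl mul1r; lra.
Unshelve. all: by end_near. Qed.

(** * Lower bound for the time left before blow-up *)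

(** If the inequality failed, the barrier started at [t0] would remain valid at every time before
    [T], keeping [u] below [m + 2] and contradicting blow-up. *)
Lemma blowup_gap (R : realType) n (rho p q lambda T : R)
    (u0 : 'rV[R]_n -> R) (u : 'rV[R]_n -> R -> R) :
  0 < rho -> 0 < p -> 0 < q -> 0 < lambda ->
  classical_solution rho p q lambda T u0 u ->
  (fun t => sup [set u x t | x in ecball rho]) @ T^'- --> +oo ->
  exists2 C, 0 < C & forall t0 m, 0 < t0 < T -> 0 <= m ->
    (forall x, ecball rho x -> u x t0 <= m) ->
    1 <= C * expR (2 * Num.max p q * m) * (T - t0).
Proof.
move=> rho0 p0 q0 lambda0 sol blow; set alpha := Num.max p q.
have pa : p <= alpha by rewrite le_max lexx.
have qa : q <= alpha by rewrite le_max lexx orbT.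
(* [D] absorbs the 2 in [m + 2]. With N = kappa E, where E = exp(alpha m), [kappa] makes
   [N * rho / 2] equal to twice D E; [C] collects the terms that B = C E^2 must dominate, using E <=
   E^2, and its 1 gives strictness. *)
pose D := expR (alpha * 2); have D0 : 0 < D := expR_gt0 _.
have [kappa kappaE kappa0] : exists2 kappa, kappa = 4 * D / rho & 0 < kappa.
  by eexists; first reflexivity; rewrite divr_gt0// mulr_gt0.
pose C := 2 * kappa * n%:R + 4 * kappa ^+ 2 * rho ^+ 2 + lambda * D + 1.
have n0 : 0 <= 2 * kappa * n%:R.
  by apply: mulr_ge0 => //; apply: mulr_ge0 => //; exact: ltW.
have kr0 : 0 <= 4 * kappa ^+ 2 * rho ^+ 2 by rewrite -mulrA -exprMn mulr_ge0 ?sqr_ge0.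
have lD0 : 0 < lambda * D by rewrite mulr_gt0.
have C0 : 0 < C by rewrite /C; lra.
exists C => // t0 m /andP[t00 t0T] m0 um; rewrite leNgt; apply/negP => gap.
pose E := expR (alpha * m).
have E1 : 1 <= E by rewrite -expR0 ler_expR mulr_ge0// (le_trans (ltW p0)).
have EE : expR (2 * alpha * m) = E ^+ 2 by rewrite -expRM_natl -mulrA.
rewrite EE in gap.
have exp_le (r : R) : 0 < r -> r <= alpha -> expR (r * (m + 2)) <= D * E.
  move=> r0 ra; rewrite /D /E -expRD -mulrDr (addrC 2) ler_expR.
  by apply: ler_wpM2r; lra.
have ubd t1 x : ecball rho x -> t0 <= t1 < T -> u x t1 <= m + 2.
  move=> xrho /andP[t0t1 t1T].
  apply: (supersolution_bound (N := kappa * E) (B := C * E ^+ 2) (t0 := t0) (t1 := t1)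
    rho0 p0 q0 lambda0 sol _ t1T) => //.
  - exact: ltW.
  - by rewrite mulr_gt0// (lt_le_trans ltr01).
  - by rewrite mulr_gt0// exprn_gt0// (lt_le_trans ltr01).
  - apply: le_trans (ltW gap); apply: ler_wpM2l; last by lra.
    by rewrite mulr_ge0 ?sqr_ge0// ltW.
  - apply: le_lt_trans (exp_le _ q0 qa) _.
    rewrite (_ : _ / 2 = 2 * (D * E)); last by rewrite kappaE; field; rewrite gt_eqF.
    have : 0 < D * E by rewrite mulr_gt0// (lt_le_trans ltr01).
    lra.
  - have := exp_le _ p0 pa => /(ler_wpM2l (ltW lambda0)).
    have : E <= E ^+ 2 by rewrite expr2 ler_peMl// (le_trans ler01).
    move=> EE2; have h1 := ler_wpM2l n0 EE2; have h2 := ler_wpM2l (ltW lD0) EE2.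
    have := lt_le_trans ltr01 E1.
    rewrite /C; nra.
  - by rewrite t0t1 lexx.
have /cvgryPgt /(_ (m + 2)) := blow.
move=> blow'.
have [t [t0t tT]] : exists t, [/\ t0 <= t, t < T & m + 2 < sup [set u x t | x in ecball rho]].
  have : \forall t \near T^'-, [/\ t0 <= t, t < T & m + 2 < sup [set u x t | x in ecball rho]].
    near=> t; split; near: t; [exact: nbhs_left_ge|exact: nbhs_left_lt|exact: blow'].
  exact: filter_ex.
(* [ge_sup] asks for a nonempty set; the centre of the ball provides a value. *)
apply/negP; rewrite -leNgt; apply: ge_sup.
  exists (u 0 t), 0 => //; rewrite /ecball/= -[0](scale0r (0 : 'rV[R]_n)) enormZ normr0 mul0r.
  exact: ltW.
by move=> _ [x xrho <-]; apply: ubd; rewrite ?t0t.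
Unshelve. all: by end_near. Qed.

(** * The logarithmic lower bound on the boundary *)

Unset Implicit Arguments.

Theorem theorem3p1 (R : realType) (n : nat) (rho p q lambda T : R)
    (u0 : 'rV[R]_n -> R) (u : 'rV[R]_n -> R -> R)
    (n_ge1 : (1 <= n)%N) (rho_gt0 : 0 < rho)
    (p_gt0 : 0 < p) (q_gt0 : 0 < q) (lambda_gt0 : 0 < lambda)
    (u0_smooth : smooth_on (ecball rho) u0)
    (u0_ge0 : forall x : 'rV[R]_n, ecball rho x -> 0 <= u0 x)
    (u0_radial : radial_on (ecball rho) u0)
    (u0_nondecreasing : forall x y : 'rV[R]_n, ecball rho x -> ecball rho y ->
       enorm x <= enorm y -> u0 x <= u0 y)
    (u0_boundary : forall x : 'rV[R]_n, esphere rho x ->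
       has_normal_derivative rho u0 x (expR (q * u0 x)))
    (u0_subsolution : forall x : 'rV[R]_n, ecball rho x ->
       0 <= laplacian u0 x + lambda * expR (p * u0 x))
    (u0_r_ge0 : forall x : 'rV[R]_n, ecball rho x -> 0 <= derive1 (profile u0) (enorm x))
    (u_blowup : blowup_time rho p q lambda T u0 u)
    (u_radial : forall t, 0 <= t < T -> radial_on (ecball rho) (u ^~ t)) :
  exists2 c : R, 0 < c &
    forall t : R, 0 < t < T ->
      ln c - (2 * Num.max p q)^-1 * ln (T - t) <= profile (u ^~ t) rho.
Proof.
have [T0 sol _ blow] := u_blowup.
have [[_ _ ucont] _ _ init] := sol.
set alpha := Num.max p q.
have alpha0 : 0 < alpha by rewrite lt_max p_gt0.
pose xR := rho *: unit_vec R n.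
have xRE : enorm xR = rho by rewrite enormZ enorm_unit_vec// mulr1 gtr0_norm.
have xRrho : ecball rho xR by rewrite /ecball/= xRE.
have mono0 := initial_nondecreasing rho_gt0 T0 ucont init u0_nondecreasing.
have umax t x : 0 < t < T -> ecball rho x -> u x t <= u xR t.
  move=> /andP[t0 tT] xrho.
  apply: (solution_radially_nondecreasing rho_gt0 p_gt0 lambda_gt0 sol u_radial mono0) => //.
    by rewrite ltW.
  by rewrite xRE.
have [C C0 gap] := blowup_gap rho_gt0 p_gt0 q_gt0 lambda_gt0 sol blow.
have [mlow mlow0 mlowP] : exists2 mlow, mlow <= 0 &
    forall t, 0 < t < T -> 1 <= C * (T - t) -> mlow <= u xR t.
  (* The condition [1 <= C * (T - t)] means [t <= b]. If [b <= 0] no positive [t] satisfies it;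
     otherwise [u xR] has a minimum on [0, b]. The minimum with 0 below ensures [mlow <= 0], which
     the case of nonnegative boundary values uses. *)
  pose b := T - C^-1; have [b0|b0] := leP b 0.
    exists 0 => // t /andP[t0 tT]; rewrite -ler_pdivrMl// mulr1 => tC.
    by exfalso; move: b0; rewrite /b; lra.
  have bT : b < T by rewrite /b ltrBlDr ltrDl invr_gt0.
  have slice : {within `[0, b], continuous (u xR)}.
    apply: (continuous_subspaceW (B := [set t | 0 <= t < T])).
      by move=> t /=; rewrite in_itv/= => /andP[-> tb]; exact: le_lt_trans bT.
    exact: (within_continuous_slice ucont xRrho).
  have [t0 _ t0min] := EVT_min (ltW b0) slice.
  exists (Num.min 0 (u xR t0)); first by rewrite ge_min lexx.
  move=> t /andP[tpos tT]; rewrite -ler_pdivrMl// mulr1 => tC.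
  apply: le_trans (t0min t _); first by rewrite ge_min lexx orbT.
  by rewrite in_itv/= ltW//=; rewrite /b; lra.
(* Taking logarithms in the gap inequality produces the term in [ln C]; [mlow] covers the times at
   which the boundary value is negative. *)
exists (expR (mlow - (2 * alpha)^-1 * ln C)); first exact: expR_gt0.
move=> t tT; rewrite expRK -/xR /profile -/xR.
have Tt : 0 < T - t by rewrite subr_gt0; case/andP: tT.
have a20 : 0 < (2 * alpha)^-1 by rewrite invr_gt0 mulr_gt0.
have [m0|m0] := leP 0 (u xR t).
  have := gap t (u xR t) tT m0 (fun x => umax t x tT).
  rewrite -/alpha -(ler_ln _ _) ?posrE ?ltr01 ?mulr_gt0 ?expR_gt0// ln1.
  rewrite !lnM ?posrE ?mulr_gt0 ?expR_gt0// expRK => h.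
  have uE : (2 * alpha)^-1 * (2 * alpha * u xR t) = u xR t.
    by rewrite mulKf// gt_eqF// mulr_gt0.
  have := ler_wpM2l (ltW a20) h; rewrite mulr0 !mulrDr uE; lra.
(* A negative boundary value allows the gap inequality with 0 for [m]. Then ln C + ln(T - t) >= 0,
   so the claimed lower bound is at most [mlow]. *)
have gap0 : 1 <= C * (T - t).
  have := gap t 0 tT (lexx _) (fun x xr => le_trans (umax t x tT xr) (ltW m0)).
  by rewrite mulr0 expR0 mulr1.
have := mlowP t tT gap0.
have : 0 <= ln C + ln (T - t) by rewrite -lnM ?posrE// ln_ge0.
move=> /(mulr_ge0 (ltW a20)); rewrite mulrDr; lra.
Qed.
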